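(* For any string $S$, $|\mathcal{PS}_S| \leq 2|S| - |\mathcal{M}_S|$.
   Context: For a string $S$ of length $n$ and $1 \le i \le j \le n$, $S[i..j]$ is the substring from position $i$ to position $j$, and $\#\mathit{occ}_S(w)$ is the number of positions $i$ with $S[i..i+|w|-1]=w$. A non-empty substring $w$ is unique if $\#\mathit{occ}_S(w)=1$ and repeating if $\#\mathit{occ}_S(w)\ge 2$; an interval $[i,j]$ is called unique/repeating according to $S[i..j]$. An interval $[i,j]$ is a minimal unique substring (MUS) of $S$ if $S[i..j]$ is unique and every proper substring $S[i'..j']$ with $i\le i'$, $j'\le j$, $j'-i'<j-i$ is repeating; $\mathcal{M}_S$ is the set of all MUS intervals of $S$. For intervals, $[s,t]\subset[i,j]$ means $i\le s$ and $t\le j$. For an interval $[s,t]$, an interval $[i,j]$ is a shortest unique substring (SUS) for $[s,t]$ if (1) $S[i..j]$ is unique, (2) $[s,t]\subset[i,j]$, and (3) $S[i'..j']$ is repeating for every $[i',j']$ with $[s,t]\subset[i',j']$ and $j'-i'<j-i$. $\mathsf{SUS}_S(p)$ denotes the set of SUSs for $[p,p]$, and $\mathcal{PS}_S=\bigcup_{p=1}^{n}\mathsf{SUS}_S(p)$ is the set of all point SUSs of $S$. *)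

(* Defs.v *)
From mathcomp Require Import all_boot all_order all_algebra.

Set Implicit Arguments.
Unset Strict Implicit.
Unset Printing Implicit Defensive.

Section PointSUS.

Variable T : eqType.

(* S[i..j], with 1-based positions; meaningful when 1 <= i. *)
Definition substr (S : seq T) (i j : nat) : seq T :=
  take (j.+1 - i) (drop i.-1 S).

Definition occ (S w : seq T) : nat :=
  count (fun i => ((i + size w).-1 <= size S) &&
                  (substr S i (i + size w).-1 == w))
        (iota 1 (size S)).

Definition is_unique (S w : seq T) : bool := (w != [::]) && (occ S w == 1).

Definition is_repeating (S w : seq T) : bool := (w != [::]) && (2 <= occ S w).

(* Pairs (i, j) with 0 <= i, j <= |S|; the actual intervals [i, j] of S are
   those satisfying is_interval below. *)
Definition str_interval (S : seq T) : predArgType :=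
  ('I_(size S).+1 * 'I_(size S).+1)%type.

Definition is_interval (S : seq T) (I : str_interval S) : bool :=
  (1 <= I.1) && (I.1 <= I.2).

Definition uniqueI (S : seq T) (I : str_interval S) : bool :=
  is_unique S (substr S I.1 I.2).

Definition repeatingI (S : seq T) (I : str_interval S) : bool :=
  is_repeating S (substr S I.1 I.2).

(* Non-strict inclusion of intervals. *)
Definition subI (S : seq T) (I J : str_interval S) : bool :=
  (J.1 <= I.1) && (I.2 <= J.2).

(* Compares lengths minus one; no truncation occurs on actual intervals. *)
Definition shorterI (S : seq T) (I J : str_interval S) : bool :=
  I.2 - I.1 < J.2 - J.1.

Definition MUS (S : seq T) : {set str_interval S} :=
  [set I : str_interval S |
    [&& is_interval I, uniqueI I &
      [forall J : str_interval S,
         [&& is_interval J, subI J I & shorterI J I] ==> repeatingI J]]].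

Definition SUS (S : seq T) (K : str_interval S) : {set str_interval S} :=
  [set I : str_interval S |
    [&& is_interval I, uniqueI I, subI K I &
      [forall J : str_interval S,
         [&& is_interval J, subI K J & shorterI J I] ==> repeatingI J]]].

Definition point_SUS (S : seq T) : {set str_interval S} :=
  \bigcup_(p : 'I_(size S).+1 | 1 <= p) SUS (p, p).

End PointSUS.

(* Main.v *)
Require Import Defs.
From mathcomp Require Import all_boot all_order all_algebra.
From mathcomp Require Import zify.

(** Let [E1] (resp. [E2]) be the set of unique intervals that are shortest among
    the unique intervals with the same start (resp. the same end).  Each has at
    most [n] elements, one per position.  A MUS lies in both.  A point SUS
    [[i, j]] for [p] lies in one of them: otherwise there are unique intervals
    [[i, j']] and [[i', j]] strictly inside it, both of which must miss [p], so
    that [i <= j' < p < i'].  But then [[p, j]] contains [p] and is shorter than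
    [[i, j]], hence repeating, although it contains the unique [[i', j]].  So
    [|PS| + |M| <= |E1 :|: E2| + |E1 :&: E2| = |E1| + |E2| <= 2n]. *)

Set Implicit Arguments.
Unset Strict Implicit.
Unset Printing Implicit Defensive.

Section Occurrences.

Variable T : eqType.
Implicit Types S v w : seq T.

Lemma size_substr S i j :
  0 < i -> j <= size S -> size (substr S i j) = j.+1 - i.
Proof. by move=> ? ?; rewrite size_take_min size_drop; lia. Qed.

Lemma infix_substr S i j k l :
  i <= k -> l <= j -> infix (substr S k l) (substr S i j).
Proof.
move=> le_ik le_lj; have [lt_lk | le_kl] := ltnP l k.
  by rewrite /substr (eqP lt_lk) take0 infix0s.
have -> : substr S k l = take (l.+1 - k) (drop (k.-1 - i.-1) (substr S i j)).
  rewrite /substr [in RHS]take_drop take_takel; last by lia.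
  by rewrite -take_drop drop_drop subnK //; lia.
exact: infix_trans (infix_take _ _) (infix_drop _ _).
Qed.

Lemma occE S w :
  occ S w = count (fun i => prefix w (drop i S)) (iota 0 (size S)).
Proof.
rewrite /occ (iotaDl 1 0) count_map; apply: eq_in_count => i.
rewrite mem_iota add0n /= => lt_iS; rewrite prefixE /substr add1n /=.
rewrite subSS addKn andb_idl // => /eqP/(congr1 size).
by rewrite size_take_min size_drop; lia.
Qed.

Lemma leq_occ_infix S v w : w != [::] -> infix w v -> occ S v <= occ S w.
Proof.
rewrite -size_eq0 -lt0n => w_gt0 /infixP[u [u' ->]].
rewrite !occE -!size_filter -(size_map (addn (size u))).
apply: uniq_leq_size => [|_ /mapP[i + ->]].
  by rewrite map_inj_uniq ?filter_uniq ?iota_uniq //; apply: addnI.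
rewrite !mem_filter !mem_iota => /andP[/prefixP[s def_s] _].
have {def_s} def_w : drop (size u + i) S = w ++ u' ++ s.
  by rewrite -drop_drop def_s -!catA drop_size_cat.
rewrite def_w prefix_prefix /=.
by move/(congr1 size): def_w; rewrite size_drop size_cat; lia.
Qed.

End Occurrences.

Section Intervals.

Variables (T : eqType) (S : seq T).
Implicit Types I J K : str_interval S.

Lemma repeatingI_not_uniqueI I : repeatingI I -> ~~ uniqueI I.
Proof. by case/andP=> _ occ_gt1; apply/nandP; right; lia. Qed.

Lemma repeatingI_subI I J :
  is_interval I -> subI I J -> repeatingI J -> repeatingI I.
Proof.
move=> /andP[I_gt0 le_I] /andP[le_JI le_IJ] /andP[_ occ_gt1].
have I_neq_nil : substr S I.1 I.2 != [::].
  by rewrite -size_eq0 size_substr ?leq_ord //; lia.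
rewrite /repeatingI /is_repeating I_neq_nil andTb.
apply: leq_trans occ_gt1 _.
exact: (leq_occ_infix S I_neq_nil (infix_substr S le_JI le_IJ)).
Qed.

Lemma subI_anti I J : subI I J -> subI J I -> I = J.
Proof.
case: I J => [i j] [k l] /andP[/= ? ?] /andP[/= ? ?].
by congr pair; apply: val_inj => /=; lia.
Qed.

Lemma MUS_not_subI I J :
  I \in MUS S -> is_interval J -> uniqueI J -> shorterI J I -> ~~ subI J I.
Proof.
rewrite inE => /and3P[_ _ /forallP/(_ J)/implyP minI] intJ uJ ltJI.
apply: contraL uJ => subJI; apply/repeatingI_not_uniqueI/minI.
exact/and3P.
Qed.

Lemma SUS_repeatingI I J K :
  I \in SUS K -> is_interval J -> subI K J -> shorterI J I -> repeatingI J.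
Proof.
rewrite inE => /and4P[_ _ _ /forallP/(_ J)/implyP minI] intJ subKJ ltJI.
exact/minI/and3P.
Qed.

Lemma SUS_not_subI I J K :
  I \in SUS K -> is_interval J -> uniqueI J -> shorterI J I -> ~~ subI K J.
Proof.
move=> susI intJ uJ ltJI; apply: contraL uJ => subKJ.
exact/repeatingI_not_uniqueI/(SUS_repeatingI susI).
Qed.

Definition shortest_unique_by (rT : eqType) (f : str_interval S -> rT) :
    {set str_interval S} :=
  [set I | [&& is_interval I, uniqueI I &
    [forall J : str_interval S,
      [&& is_interval J, uniqueI J & f J == f I] ==> ~~ shorterI J I]]].

Lemma notin_shortest_unique_by (rT : eqType) (f : str_interval S -> rT) I :
    is_interval I -> uniqueI I -> I \notin shortest_unique_by f ->
  exists J, [/\ is_interval J, uniqueI J, f J = f I & shorterI J I].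
Proof.
rewrite inE => -> -> /forallPn[J]; rewrite negb_imply negbK.
by case/andP=> /and3P[intJ uJ /eqP eqfJ] ltJI; exists J.
Qed.

Definition fibers_nested (rT : eqType) (f : str_interval S -> rT) : Prop :=
  forall I J, is_interval I -> is_interval J -> f I = f J ->
    I.2 - I.1 <= J.2 - J.1 -> subI I J.

Lemma start_fibers_nested : fibers_nested (fun I => I.1).
Proof.
by move=> I J /andP[_ ?] /andP[_ ?] /(congr1 val) /= ? ?; rewrite /subI; lia.
Qed.

Lemma end_fibers_nested : fibers_nested (fun I => I.2).
Proof.
by move=> I J /andP[_ ?] /andP[_ ?] /(congr1 val) /= ? ?; rewrite /subI; lia.
Qed.

Lemma shortest_unique_by_inj (rT : eqType) (f : str_interval S -> rT) :
  fibers_nested f -> {in shortest_unique_by f &, injective f}.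
Proof.
move=> nested_f I J; rewrite !inE => /and3P[intI uI /forallP/(_ J) minI].
move=> /and3P[intJ uJ /forallP/(_ I) minJ] eqf; move: minI minJ.
rewrite intI intJ uI uJ eqf eqxx /= /shorterI -!leqNgt => leIJ leJI.
by apply: subI_anti; apply: nested_f.
Qed.

Lemma card_shortest_unique_by (f : str_interval S -> 'I_(size S).+1) :
    fibers_nested f -> (forall I, is_interval I -> 0 < f I) ->
  #|shortest_unique_by f| <= size S.
Proof.
move=> nested_f f_gt0.
rewrite -(card_in_imset (shortest_unique_by_inj nested_f)).
have card_positions : #|[set~ (ord0 : 'I_(size S).+1)]| = size S.
  by rewrite cardsC1 card_ord.
rewrite -[leqRHS]card_positions.
apply/subset_leq_card/subsetP => _ /imsetP[I + ->].
by rewrite !inE -lt0n => /and3P[/f_gt0].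
Qed.

Lemma MUS_shortest_unique_by (rT : eqType) (f : str_interval S -> rT) :
  fibers_nested f -> MUS S \subset shortest_unique_by f.
Proof.
move=> nested_f; apply/subsetP => I musI.
have := musI; rewrite inE => /and3P[intI uI _].
rewrite inE intI uI; apply/forallP => J; apply/implyP.
case/and3P=> intJ uJ /eqP eqf; apply/negP => ltJI.
by have /negP[] := MUS_not_subI musI intJ uJ ltJI; apply/nested_f/ltnW.
Qed.

Lemma point_SUS_shortest_unique_by :
  point_SUS S \subset
    shortest_unique_by (fun I => I.1) :|: shortest_unique_by (fun I => I.2).
Proof.
apply/subsetP => I /bigcupP[p p_gt0 susI].
have := susI; rewrite inE => /and4P[intI uI /andP[/= le_Ip le_pI] _].
rewrite inE; apply: contraT; rewrite negb_or => /andP[].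
move=> /(notin_shortest_unique_by intI uI)[J [intJ uJ eqJ ltJI]].
move=> /(notin_shortest_unique_by intI uI)[K [intK uK eqK ltKI]].
have lt_Jp : J.2 < p.
  by have := SUS_not_subI susI intJ uJ ltJI; rewrite /subI eqJ /=; lia.
have lt_pK : p < K.1.
  by have := SUS_not_subI susI intK uK ltKI; rewrite /subI eqK /=; lia.
have int_pI : is_interval (p, I.2) by rewrite /is_interval /= p_gt0.
have rep_pI : repeatingI (p, I.2).
  apply: SUS_repeatingI susI int_pI _ _; first by rewrite /subI /= leqnn.
  by case/andP: intJ; rewrite /shorterI eqJ /=; lia.
have repK : repeatingI K.
  by apply: repeatingI_subI rep_pI => //; rewrite /subI eqK /= leqnn ltnW.
by have := repeatingI_not_uniqueI repK; rewrite uK.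
Qed.

End Intervals.

Theorem theorem1 (T : eqType) (S : seq T) :
  (#|point_SUS S|%:Z <= 2%:Z * (size S)%:Z - #|MUS S|%:Z)%R.
Proof.
set E1 := shortest_unique_by (fun I : str_interval S => I.1).
set E2 := shortest_unique_by (fun I : str_interval S => I.2).
have card_PS : #|point_SUS S| <= #|E1 :|: E2|.
  exact/subset_leq_card/point_SUS_shortest_unique_by.
have card_M : #|MUS S| <= #|E1 :&: E2|.
  apply/subset_leq_card; rewrite subsetI; apply/andP; split.
    exact/MUS_shortest_unique_by/start_fibers_nested.
  exact/MUS_shortest_unique_by/end_fibers_nested.
have card_E1 : #|E1| <= size S.
  apply: card_shortest_unique_by; first exact: start_fibers_nested.
  by move=> I /andP[].
have card_E2 : #|E2| <= size S.
  apply: card_shortest_unique_by; first exact: end_fibers_nested.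
  by move=> I /andP[I_gt0 /(leq_trans I_gt0)].
have := cardsUI E1 E2; lia.
Qed.
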